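(* Let $X$ be a Banach space and $k\in\mathbb N$, $k\ge2$. If $X$ is locally uniformly rotund, then $X$ is locally fully $k$-rotund.
   Context: $S_X$ is the unit sphere of $X$. $X$ is locally uniformly rotund if for every $x\in X$ and every sequence $(x_n)\subset X$ with $\|x_n+x\|_X\to2\|x\|_X$ and $\|x_n\|_X\to\|x\|_X$ one has $\|x_n-x\|_X\to0$. $X$ is locally fully $k$-rotund if for every $x\in S_X$ and every sequence $(x_n)\subset S_X$ such that $\|x+\sum_{i=1}^k x_{n,i}\|_X\to k+1$ as $n\to\infty$ for any $k$ subsequences $(x_{n,1})_n,\dots,(x_{n,k})_n$ of $(x_n)$, the sequence $x_n$ converges to $x$ in $X$. *)

(* Defs.v *)
From HB Require Import structures.
From mathcomp Require Import all_boot all_order all_algebra.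
From mathcomp Require Import all_classical all_reals all_analysis.

Set Implicit Arguments.
Unset Strict Implicit.
Unset Printing Implicit Defensive.

Import Order.TTheory GRing.Theory Num.Theory.
Import numFieldNormedType.Exports.

Local Open Scope classical_set_scope.
Local Open Scope ring_scope.

(* The scalar field is an arbitrary numFieldType so that real spaces
   (K : realType) and complex spaces (K := R[i]) are both covered; norms take
   their values in K. *)

Definition unit_sphere (K : numFieldType) (X : normedModType K) : set X :=
  [set x | `|x| = 1].

Definition locally_uniformly_rotund (K : numFieldType) (X : normedModType K)
    : Prop :=
  forall (x : X) (u : nat -> X),
    (fun n => `|u n + x|) @ \oo --> 2 * `|x| ->
    (fun n => `|u n|) @ \oo --> `|x| ->
    (fun n => `|u n - x|) @ \oo --> (0 : K).

(* The i-th subsequence of u is u \o s i, with s i strictly increasing. The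
   quantification over s belongs to the hypothesis on u. *)
Definition locally_fully_rotund (k : nat) (K : numFieldType)
    (X : normedModType K) : Prop :=
  forall (x : X) (u : nat -> X),
    unit_sphere x -> (forall n, unit_sphere (u n)) ->
    (forall s : 'I_k -> nat -> nat,
      (forall i, {homo s i : m n / (m < n)%N}) ->
      (fun n => `|x + \sum_(i < k) u (s i n)|) @ \oo --> (k.+1%:R : K)) ->
    u @ \oo --> x.

(* Main.v *)
(* Taking all k subsequences equal to (x_n) gives |x + k x_n| -> k + 1.  Since
   |x + k x_n| <= |x + x_n| + (k - 1), the defect 2 - |x + x_n| lies between 0
   and k + 1 - |x + k x_n|, so |x_n + x| -> 2 and local uniform rotundity
   applies. *)

Require Import Defs.
From mathcomp Require Import all_boot all_order all_algebra.
From mathcomp Require Import all_classical all_reals all_analysis.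

Set Implicit Arguments.
Unset Strict Implicit.
Unset Printing Implicit Defensive.

Import Order.TTheory GRing.Theory Num.Theory.
Import numFieldNormedType.Exports.

Local Open Scope classical_set_scope.
Local Open Scope ring_scope.

(** Here [k.+1] counts the copies of [y]: one stays with [x], the other [k] cost at most [k] in
    norm. *)
Lemma unit_norm_defect_le (K : numFieldType) (X : normedModType K) (x y : X)
    (k : nat) : `|x| = 1 -> `|y| = 1 ->
  `|2 - `|y + x| | <= `|k.+2%:R - `|x + y *+ k.+1| |.
Proof.
move=> x1 y1.
have yx2 : `|y + x| <= 2 by rewrite (le_trans (ler_normD _ _))// x1 y1.
have xky : `|x + y *+ k.+1| <= `|y + x| + k%:R.
  rewrite mulrS addrA (addrC x) (le_trans (ler_normD _ _))// normrMn y1.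
  by rewrite lerD2l.
have xk : `|x + y *+ k.+1| <= k.+2%:R.
  by rewrite (le_trans xky)// -[k.+2]/(2 + k)%N (natrD _ 2 k) lerD2r.
(* Both defects are nonnegative by [yx2] and [xk]; what remains is [xky] rearranged. *)
rewrite ger0_norm ?subr_ge0// ger0_norm ?subr_ge0//.
rewrite lerBlDr addrAC lerBrDr -[k.+2]/(2 + k)%N (natrD _ 2 k).
by rewrite -(addrA 2 k%:R) lerD2l addrC.
Qed.

Local Close Scope ring_scope.
Local Close Scope classical_set_scope.

Theorem theorem4p8 (K : numFieldType) (X : completeNormedModType K) (k : nat)
    (hk : (2 <= k)%N) :
  locally_uniformly_rotund X -> locally_fully_rotund k X.
Proof.
case: k hk => [//|k] _ lur x u x1 u1 uk.
have {}uk := uk (fun _ n => n) (fun _ _ _ lt_mn => lt_mn).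
apply/subr_cvg0/norm_cvg0P; apply: lur; last first.
  by under eq_fun do rewrite u1; rewrite x1; exact: cvg_cst.
rewrite x1 mulr1; apply/cvgrPdist_lt => e e0.
(* The defect bound has constant 1, so the same [e] serves for both limits. *)
move/cvgrPdist_lt/(_ _ e0): uk; apply: filterS => n.
rewrite sumr_const card_ord; apply: le_lt_trans.
exact: (unit_norm_defect_le k x1 (u1 n)).
Qed.
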